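(* Let $\mathcal{G}$ be a strict 2-group presented by a crossed module $(G,H,\rhd,\partial)$ acting strictly on a small category $\mathbf{C}$ by $\Phi$. The vertical 2-category $V(\mathbf{C}/\!\!/\mathcal{G})$ of the transformation double category $\mathbf{C}/\!\!/\mathcal{G}$ associated to this action has the same objects and 1-morphisms as the transformation groupoid $\mathbf{C}^{(0)}/\!\!/\mathcal{G}^{(0)}$ of the group $\mathcal{G}^{(0)}=G$ acting on the set $\mathbf{C}^{(0)}$ of objects of $\mathbf{C}$. Given an object $x$ of $\mathbf{C}$ and $\gamma,\gamma'\in G$ such that $\gamma\blacktriangleright x=\gamma'\blacktriangleright x$, there will be a 2-morphism from $(\gamma,x)$ to $(\gamma',x)$ for each $\chi\in H$ such that $$\Phi_{(\gamma,\chi)}(x)=\mathrm{Id}_{\gamma\blacktriangleright x}\quad\text{and}\quad\gamma'=\partial(\chi)\gamma.$$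
   Context: A crossed module $(G,H,\rhd,\partial)$ consists of groups $G,H$, an action $\rhd$ of $G$ on $H$ by automorphisms, and a homomorphism $\partial:H\to G$ with $\partial(g\rhd\eta)=g\,\partial(\eta)g^{-1}$ and $\partial(\eta)\rhd\zeta=\eta\zeta\eta^{-1}$. The 2-group $\mathcal{G}$ presented by it is the strict 2-category with one object, 1-morphisms the elements of $G$ (composition = multiplication), and 2-morphisms $(\gamma,\chi)\in G\times H$, $(\gamma,\chi):\gamma\Rightarrow\partial(\chi)\gamma$, with vertical composition $(\partial(\chi)\gamma,\chi')\cdot(\gamma,\chi)=(\gamma,\chi'\chi)$, identities $(\gamma,1_H)$, and horizontal composition $(\gamma_1,\chi_1)\circ(\gamma_3,\chi_2)=(\gamma_1\gamma_3,\chi_1(\gamma_1\rhd\chi_2))$. A strict action of $\mathcal{G}$ on $\mathbf{C}$ is a strict 2-functor $\Phi:\mathcal{G}\to\mathbf{Cat}$ sending the unique object to $\mathbf{C}$: endofunctors $\Phi_\gamma:\mathbf{C}\to\mathbf{C}$ and natural transformations $\Phi_{(\gamma,\chi)}:\Phi_\gamma\Rightarrow\Phi_{\partial(\chi)\gamma}$, strictly preserving all compositions and identities. Notation: $\gamma\blacktriangleright x=\Phi_\gamma(x)$ and $(\gamma,\chi)\blacktriangleright f=\Phi_{(\gamma,\chi)}(y)\circ\Phi_\gamma(f)$ for $f:x\to y$ in $\mathbf{C}$. The transformation groupoid $\mathbf{C}^{(0)}/\!\!/\mathcal{G}^{(0)}$ has objects $\mathbf{C}^{(0)}$, morphisms $(\gamma,x):x\to\gamma\blacktriangleright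 x$ with $\gamma\in G$, and composition $(\gamma',\gamma\blacktriangleright x)\circ(\gamma,x)=(\gamma'\gamma,x)$. The transformation double category $\mathbf{C}/\!\!/\mathcal{G}$ has: objects those of $\mathbf{C}$; horizontal category $\mathbf{C}$; vertical category $\mathbf{C}^{(0)}/\!\!/\mathcal{G}^{(0)}$; squares $((\gamma,\chi),f)$, $(\gamma,\chi)\in G\times H$, $f:x\to y$ in $\mathbf{C}$, with left edge (horizontal source) $(\gamma,x)$, right edge (horizontal target) $(\partial(\chi)\gamma,y)$, top edge $f$, bottom edge $(\gamma,\chi)\blacktriangleright f$; horizontal composition $((\partial(\chi_1)\gamma_1,\chi_2),g)\circ_h((\gamma_1,\chi_1),f)=((\gamma_1,\chi_2\chi_1),g\circ f)$; vertical composition $((\gamma_1,\chi_1),(\gamma_3,\chi_2)\blacktriangleright f)\circ_v((\gamma_3,\chi_2),f)=((\gamma_1\gamma_3,\chi_1(\gamma_1\rhd\chi_2)),f)$. The vertical 2-category $V(\mathcal{D})$ of a double category $\mathcal{D}$ has the same objects and 1-morphisms as the vertical category of $\mathcal{D}$; its 2-morphisms are the squares of $\mathcal{D}$ whose two horizontal boundary morphisms (top and bottom edges) are identities, regarded as 2-morphisms from the horizontal source to the horizontal target, with the compositions of squares in $\mathcal{D}$. *)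

(* Defs.v *)
From mathcomp Require Import all_boot.
From mathcomp Require Import boolp.

Set Implicit Arguments.
Unset Strict Implicit.
Unset Printing Implicit Defensive.

Local Open Scope group_scope.

(* Small categories are given by a set of objects and a set of morphisms with
   source and target maps, so that the strict equations between 1-morphisms
   needed for 2-categories and double categories involve no transport.
   Composition is defined only on composable pairs: [cmp g f e] is "g after f",
   and [e] proves that they are composable. *)
Record cat_structure (O M : Type) := CatStructure {
  src : M -> O;
  tgt : M -> O;
  idm : O -> M;
  cmp : forall g f : M, tgt f = src g -> M;
  src_idm : forall x, src (idm x) = x;
  tgt_idm : forall x, tgt (idm x) = x;
  src_cmp : forall g f (e : tgt f = src g), src (@cmp g f e) = src f;
  tgt_cmp : forall g f (e : tgt f = src g), tgt (@cmp g f e) = tgt g;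
  cmp_idl : forall f (e : tgt f = src (idm (tgt f))), @cmp (idm (tgt f)) f e = f;
  cmp_idr : forall f (e : tgt (idm (src f)) = src f), @cmp f (idm (src f)) e = f;
  cmpA : forall h g f (e1 : tgt f = src g) (e2 : tgt g = src h)
    (e3 : tgt (@cmp g f e1) = src h) (e4 : tgt f = src (@cmp h g e2)),
    @cmp h (@cmp g f e1) e3 = @cmp (@cmp h g e2) f e4
}.

Arguments cmp {O M} _ g f _.
Arguments cmpA {O M c h g f} e1 e2 e3 e4.

Record category := Category {
  ob : Type;
  mor : Type;
  cat_str :> cat_structure ob mor
}.

Definition is_idm O M (S : cat_structure O M) (f : M) : Prop :=
  exists x, f = idm S x.

Record is_functor (O M O' M' : Type) (S : cat_structure O M)
    (S' : cat_structure O' M') (f0 : O -> O') (f1 : M -> M') : Prop :=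
  IsFunctor {
  fun_src : forall f, src S' (f1 f) = f0 (src S f);
  fun_tgt : forall f, tgt S' (f1 f) = f0 (tgt S f);
  fun_idm : forall x, f1 (idm S x) = idm S' (f0 x);
  fun_cmp : forall g f (e : tgt S f = src S g)
    (e' : tgt S' (f1 f) = src S' (f1 g)),
    f1 (cmp S g f e) = cmp S' (f1 g) (f1 f) e'
}.

Record functor (C D : category) := Functor {
  fob : ob C -> ob D;
  fmor : mor C -> mor D;
  functorP : is_functor C D fob fmor
}.

Record nat_trans (C D : category) (F G : functor C D) := NatTrans {
  cpt : ob C -> mor D;
  src_cpt : forall x, src D (cpt x) = fob F x;
  tgt_cpt : forall x, tgt D (cpt x) = fob G x;
  naturality : forall f (e : tgt D (fmor F f) = src D (cpt (tgt C f)))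
    (e' : tgt D (cpt (src C f)) = src D (fmor G f)),
    cmp D (cpt (tgt C f)) (fmor F f) e = cmp D (fmor G f) (cpt (src C f)) e'
}.

(* A strict 2-category: [vert] composes 2-morphisms along 1-morphisms and
   [horiz] composes them along objects. In the interchange laws, here and for
   double categories, [e] and [e'] follow from the other hypotheses; quantifying
   over them, as over [e'] in [fun_cmp], avoids naming composability proofs. *)
Record two_category := TwoCategory {
  ob2 : Type;
  mor1 : Type;
  cell : Type;
  cat1 : cat_structure ob2 mor1;
  vert : cat_structure mor1 cell;
  horiz : cat_structure ob2 cell;
  src_functor : is_functor horiz cat1 id (src vert);
  tgt_functor : is_functor horiz cat1 id (tgt vert);
  idm_functor : is_functor cat1 horiz id (idm vert);
  interchange2 : forall a b c d
    (ab : tgt vert a = src vert b) (cd : tgt vert c = src vert d)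
    (ac : tgt horiz a = src horiz c) (bd : tgt horiz b = src horiz d)
    (e : tgt horiz (cmp vert b a ab) = src horiz (cmp vert d c cd))
    (e' : tgt vert (cmp horiz c a ac) = src vert (cmp horiz d b bd)),
    cmp horiz (cmp vert d c cd) (cmp vert b a ab) e
    = cmp vert (cmp horiz d b bd) (cmp horiz c a ac) e'
}.

Record two_functor (A B : two_category) := TwoFunctor {
  map0 : ob2 A -> ob2 B;
  map1 : mor1 A -> mor1 B;
  map2 : cell A -> cell B;
  map_cat1 : is_functor (cat1 A) (cat1 B) map0 map1;
  map_vert : is_functor (vert A) (vert B) map1 map2;
  map_horiz : is_functor (horiz A) (horiz B) map0 map2
}.

(* A square has left and right edges [src sqh], [tgt sqh] and top and bottom
   edges [src sqv], [tgt sqv]; [sqh] and [sqv] are the horizontal and vertical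
   compositions of squares. *)
Record double_category := DoubleCategory {
  dob : Type;
  hmor : Type;
  vmor : Type;
  sq : Type;
  hcat : cat_structure dob hmor;
  vcat : cat_structure dob vmor;
  sqh : cat_structure vmor sq;
  sqv : cat_structure hmor sq;
  top_functor : is_functor sqh hcat (src vcat) (src sqv);
  bottom_functor : is_functor sqh hcat (tgt vcat) (tgt sqv);
  left_functor : is_functor sqv vcat (src hcat) (src sqh);
  right_functor : is_functor sqv vcat (tgt hcat) (tgt sqh);
  idv_functor : is_functor hcat sqh (idm vcat) (idm sqv);
  idh_functor : is_functor vcat sqv (idm hcat) (idm sqh);
  interchange : forall a b c d
    (ab : tgt sqh a = src sqh b) (cd : tgt sqh c = src sqh d)
    (ac : tgt sqv a = src sqv c) (bd : tgt sqv b = src sqv d)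
    (e : tgt sqv (cmp sqh b a ab) = src sqv (cmp sqh d c cd))
    (e' : tgt sqh (cmp sqv c a ac) = src sqh (cmp sqv d b bd)),
    cmp sqv (cmp sqh d c cd) (cmp sqh b a ab) e
    = cmp sqh (cmp sqv d b bd) (cmp sqv c a ac) e'
}.

Record groupoid := Groupoid {
  gpd_cat :> category;
  gpd_inv : mor gpd_cat -> mor gpd_cat;
  src_inv : forall f, src gpd_cat (gpd_inv f) = tgt gpd_cat f;
  tgt_inv : forall f, tgt gpd_cat (gpd_inv f) = src gpd_cat f;
  inv_cmpl : forall f (e : tgt gpd_cat f = src gpd_cat (gpd_inv f)),
    cmp gpd_cat (gpd_inv f) f e = idm gpd_cat (src gpd_cat f);
  inv_cmpr : forall f (e : tgt gpd_cat (gpd_inv f) = src gpd_cat f),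
    cmp gpd_cat f (gpd_inv f) e = idm gpd_cat (tgt gpd_cat f)
}.

Lemma eq_cmp O M (S : cat_structure O M) g f g' f' e e' :
  g = g' -> f = f' -> cmp S g f e = cmp S g' f' e'.
Proof.
by move=> eg ef; subst g' f'; rewrite (Prop_irrelevance e e').
Qed.

Lemma cmp1m O M (S : cat_structure O M) f x (e : tgt S f = src S (idm S x)) :
  cmp S (idm S x) f e = f.
Proof.
have ex : x = tgt S f by rewrite e src_idm.
by subst x; apply: cmp_idl.
Qed.

Lemma cmpm1 O M (S : cat_structure O M) f x (e : tgt S (idm S x) = src S f) :
  cmp S f (idm S x) e = f.
Proof.
have ex : x = src S f by rewrite -e tgt_idm.
by subst x; apply: cmp_idr.
Qed.

Lemma is_idm_cmp1m O M (S : cat_structure O M) g f x (e : tgt S f = src S g) :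
  g = idm S x -> cmp S g f e = f.
Proof. by move=> eg; subst g; apply: cmp1m. Qed.

Lemma is_idm_cmpm1 O M (S : cat_structure O M) g f x (e : tgt S f = src S g) :
  f = idm S x -> cmp S g f e = g.
Proof. by move=> ef; subst f; apply: cmpm1. Qed.

Lemma eq_functor (C D : category) (F G : functor C D) :
  fob F =1 fob G -> fmor F =1 fmor G -> F = G.
Proof.
case: F G => [f0 f1 fP] [g0 g1 gP] /= /funext e0 /funext e1.
by subst g0 g1; rewrite (Prop_irrelevance fP gP).
Qed.

Section IdCompFunctor.
Variables C D E : category.

Lemma id_functorP : is_functor C C id id.
Proof. by split=> // g f e e'; apply: eq_cmp. Qed.

Definition id_functor : functor C C := Functor id_functorP.

Variables (G : functor D E) (F : functor C D).

Lemma comp_functorP : is_functor C E (fob G \o fob F) (fmor G \o fmor F).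
Proof.
have [Fs Ft Fi Fc] := functorP F; have [Gs Gt Gi Gc] := functorP G.
split=> [f|f|x|g f e e'] /=; rewrite ?Gs ?Gt ?Fs ?Ft ?Fi ?Gi //.
have e1 : tgt D (fmor F f) = src D (fmor F g) by rewrite Ft Fs e.
by rewrite (Fc _ _ _ e1) (Gc _ _ _ e').
Qed.

Definition comp_functor : functor C E := Functor comp_functorP.

End IdCompFunctor.

(* The full sub-2-category of Cat on the single object C: its 1-morphisms are
   the endofunctors of C and its 2-morphisms the natural transformations
   between these. *)
Section EndoTwoCategory.
Variable C : category.

Record endo_cell := EndoCell {
  cell_src : functor C C;
  cell_tgt : functor C C;
  cell_nat : nat_trans cell_src cell_tgt
}.

Definition cell_cpt (a : endo_cell) : ob C -> mor C := cpt (cell_nat a).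

Lemma eq_endo_cell (a b : endo_cell) :
  cell_src a = cell_src b -> cell_tgt a = cell_tgt b ->
  cell_cpt a =1 cell_cpt b -> a = b.
Proof.
rewrite /cell_cpt; case: a b => [F G [s p1 p2 p3]] [F' G' [t q1 q2 q3]] /=.
move=> eF eG /funext est; subst F' G' t.
by rewrite (Prop_irrelevance p1 q1) (Prop_irrelevance p2 q2)
           (Prop_irrelevance p3 q3).
Qed.

Lemma src_cell_cpt a x : src C (cell_cpt a x) = fob (cell_src a) x.
Proof. exact: src_cpt. Qed.

Lemma tgt_cell_cpt a x : tgt C (cell_cpt a x) = fob (cell_tgt a) x.
Proof. exact: tgt_cpt. Qed.

Lemma cell_naturality a f e e' :
  cmp C (cell_cpt a (tgt C f)) (fmor (cell_src a) f) e
  = cmp C (fmor (cell_tgt a) f) (cell_cpt a (src C f)) e'.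
Proof. exact: naturality. Qed.

Definition endo_cat1 : cat_structure unit (functor C C).
Proof.
refine (@CatStructure unit (functor C C) (fun _ => tt) (fun _ => tt)
  (fun _ => id_functor C) (fun G F _ => comp_functor G F) _ _ _ _ _ _ _).
- by case.
- by case.
- by [].
- by [].
- by move=> F e; apply: eq_functor.
- by move=> F e; apply: eq_functor.
- by move=> H G F e1 e2 e3 e4; apply: eq_functor.
Defined.

Lemma id_nat_subproof (F : functor C C) f
    (e : tgt C (fmor F f) = src C (idm C (fob F (tgt C f))))
    (e' : tgt C (idm C (fob F (src C f))) = src C (fmor F f)) :
  cmp C (idm C (fob F (tgt C f))) (fmor F f) e
  = cmp C (fmor F f) (idm C (fob F (src C f))) e'.
Proof. by rewrite cmp1m cmpm1. Qed.

Definition id_cell (F : functor C C) : endo_cell :=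
  EndoCell (@NatTrans C C F F (fun x => idm C (fob F x))
    (fun x => src_idm C _) (fun x => tgt_idm C _) (@id_nat_subproof F)).

Section Vert.
Variables (b a : endo_cell) (e : cell_tgt a = cell_src b).

Lemma vert_cpt_subproof x : tgt C (cell_cpt a x) = src C (cell_cpt b x).
Proof. by rewrite tgt_cell_cpt src_cell_cpt e. Qed.

Definition vert_cpt x : mor C :=
  cmp C (cell_cpt b x) (cell_cpt a x) (vert_cpt_subproof x).

Lemma src_vert_cpt x : src C (vert_cpt x) = fob (cell_src a) x.
Proof. by rewrite src_cmp src_cell_cpt. Qed.

Lemma tgt_vert_cpt x : tgt C (vert_cpt x) = fob (cell_tgt b) x.
Proof. by rewrite tgt_cmp tgt_cell_cpt. Qed.

Lemma vert_naturality f
    (e1 : tgt C (fmor (cell_src a) f) = src C (vert_cpt (tgt C f)))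
    (e2 : tgt C (vert_cpt (src C f)) = src C (fmor (cell_tgt b) f)) :
  cmp C (vert_cpt (tgt C f)) (fmor (cell_src a) f) e1
  = cmp C (fmor (cell_tgt b) f) (vert_cpt (src C f)) e2.
Proof.
have [As At _ _] := functorP (cell_src a).
have [Ms Mt _ _] := functorP (cell_tgt a).
have [Bs Bt _ _] := functorP (cell_tgt b).
have p1 : tgt C (fmor (cell_src a) f) = src C (cell_cpt a (tgt C f)).
  by rewrite At src_cell_cpt.
have p2 : tgt C (cell_cpt a (src C f)) = src C (fmor (cell_tgt a) f).
  by rewrite tgt_cell_cpt Ms.
have p3 : tgt C (fmor (cell_tgt a) f) = src C (cell_cpt b (tgt C f)).
  by rewrite Mt src_cell_cpt e.
have p4 : tgt C (cell_cpt b (src C f)) = src C (fmor (cell_tgt b) f).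
  by rewrite tgt_cell_cpt Bs.
have q1 : tgt C (cmp C _ _ p1) = src C (cell_cpt b (tgt C f)).
  by rewrite tgt_cmp vert_cpt_subproof.
have q2 : tgt C (cell_cpt a (src C f)) = src C (cmp C _ _ p3).
  by rewrite src_cmp p2.
have q3 : tgt C (cell_cpt a (src C f)) = src C (cmp C _ _ p4).
  by rewrite src_cmp vert_cpt_subproof.
have q4 : tgt C (cmp C _ _ p2) = src C (cell_cpt b (tgt C f)).
  by rewrite tgt_cmp p3.
rewrite /vert_cpt -(cmpA p1 _ q1) (cmpA _ p4 _ q3).
rewrite (eq_cmp q1 q4 erefl (cell_naturality p1 p2)) (cmpA p2 p3 q4 q2).
apply: eq_cmp => //.
have p3' : tgt C (fmor (cell_src b) f) = src C (cell_cpt b (tgt C f)).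
  by rewrite -e p3.
by rewrite -(cell_naturality p3' p4); apply: eq_cmp => //; rewrite e.
Qed.

Definition vert_cell : endo_cell :=
  EndoCell (NatTrans src_vert_cpt tgt_vert_cpt vert_naturality).

End Vert.

Definition endo_vert : cat_structure (functor C C) endo_cell.
Proof.
refine (@CatStructure _ _ cell_src cell_tgt id_cell vert_cell
  _ _ _ _ _ _ _) => //.
- move=> a e; apply: eq_endo_cell => // x.
  by rewrite /cell_cpt /= /vert_cpt {1}/cell_cpt /= cmp1m.
- move=> a e; apply: eq_endo_cell => // x.
  by rewrite /cell_cpt /= /vert_cpt {2}/cell_cpt /= cmpm1.
- move=> c b a e1 e2 e3 e4; apply: eq_endo_cell => // x.
  by rewrite /cell_cpt /= /vert_cpt; apply: cmpA.
Defined.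

Section Horiz.
Variables b a : endo_cell.

Lemma horiz_cpt_subproof x :
  tgt C (fmor (cell_src b) (cell_cpt a x))
  = src C (cell_cpt b (fob (cell_tgt a) x)).
Proof.
by rewrite (fun_tgt (functorP (cell_src b))) tgt_cell_cpt src_cell_cpt.
Qed.

Definition horiz_cpt x : mor C :=
  cmp C (cell_cpt b (fob (cell_tgt a) x)) (fmor (cell_src b) (cell_cpt a x))
    (horiz_cpt_subproof x).

Lemma src_horiz_cpt x :
  src C (horiz_cpt x) = fob (comp_functor (cell_src b) (cell_src a)) x.
Proof.
by rewrite src_cmp (fun_src (functorP (cell_src b))) src_cell_cpt.
Qed.

Lemma tgt_horiz_cpt x :
  tgt C (horiz_cpt x) = fob (comp_functor (cell_tgt b) (cell_tgt a)) x.
Proof. by rewrite tgt_cmp tgt_cell_cpt. Qed.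

Lemma horiz_naturality f
    (e1 : tgt C (fmor (comp_functor (cell_src b) (cell_src a)) f)
          = src C (horiz_cpt (tgt C f)))
    (e2 : tgt C (horiz_cpt (src C f))
          = src C (fmor (comp_functor (cell_tgt b) (cell_tgt a)) f)) :
  cmp C (horiz_cpt (tgt C f))
    (fmor (comp_functor (cell_src b) (cell_src a)) f) e1
  = cmp C (fmor (comp_functor (cell_tgt b) (cell_tgt a)) f)
    (horiz_cpt (src C f)) e2.
Proof.
have [As At _ _] := functorP (cell_src a).
have [Ss St _ Sc] := functorP (cell_tgt a).
have [Bs Bt _ Bc] := functorP (cell_src b).
have [Ts Tt _ _] := functorP (cell_tgt b).
have p1 : tgt C (fmor (cell_src a) f) = src C (cell_cpt a (tgt C f)).
  by rewrite At src_cell_cpt.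
have p2 : tgt C (cell_cpt a (src C f)) = src C (fmor (cell_tgt a) f).
  by rewrite tgt_cell_cpt Ss.
have b1 : tgt C (fmor (cell_src b) (fmor (cell_src a) f))
          = src C (fmor (cell_src b) (cell_cpt a (tgt C f))).
  by rewrite Bt Bs p1.
have b2 : tgt C (fmor (cell_src b) (cell_cpt a (src C f)))
          = src C (fmor (cell_src b) (fmor (cell_tgt a) f)).
  by rewrite Bt Bs p2.
pose g := fmor (cell_tgt a) f.
have p3 : tgt C (fmor (cell_src b) g) = src C (cell_cpt b (tgt C g)).
  by rewrite Bt src_cell_cpt.
have p4 : tgt C (cell_cpt b (src C g)) = src C (fmor (cell_tgt b) g).
  by rewrite tgt_cell_cpt Ts.
have p3' : tgt C (fmor (cell_src b) g)
           = src C (cell_cpt b (fob (cell_tgt a) (tgt C f))).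
  by rewrite p3 St.
have p4' : tgt C (cell_cpt b (fob (cell_tgt a) (src C f)))
           = src C (fmor (cell_tgt b) g).
  by rewrite -p4 Ss.
have q1 : tgt C (cmp C _ _ b1)
          = src C (cell_cpt b (fob (cell_tgt a) (tgt C f))).
  by rewrite tgt_cmp horiz_cpt_subproof.
have q2 : tgt C (fmor (cell_src b) (cell_cpt a (src C f)))
          = src C (cmp C _ _ p3').
  by rewrite src_cmp b2.
have q3 : tgt C (fmor (cell_src b) (cell_cpt a (src C f)))
          = src C (cmp C _ _ p4').
  by rewrite src_cmp horiz_cpt_subproof.
have q4 : tgt C (cmp C _ _ b2)
          = src C (cell_cpt b (fob (cell_tgt a) (tgt C f))).
  by rewrite tgt_cmp p3'.
have eb : cmp C _ _ b1 = cmp C _ _ b2.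
  by rewrite -(Bc _ _ p1 b1) -(Bc _ _ p2 b2) (cell_naturality p1 p2).
rewrite /horiz_cpt /= -(cmpA b1 _ q1) (cmpA _ p4' _ q3).
rewrite (eq_cmp q1 q4 erefl eb) (cmpA b2 p3' q4 q2).
apply: eq_cmp => //.
transitivity (cmp C _ _ p3); first by apply: eq_cmp; rewrite ?St.
rewrite (cell_naturality p3 p4).
by apply: eq_cmp; rewrite ?Ss.
Qed.

Definition horiz_cell : endo_cell :=
  EndoCell (NatTrans src_horiz_cpt tgt_horiz_cpt horiz_naturality).

End Horiz.

Definition endo_horiz : cat_structure unit endo_cell.
Proof.
refine (@CatStructure unit endo_cell (fun _ => tt) (fun _ => tt)
  (fun _ => id_cell (id_functor C)) (fun b a _ => horiz_cell b a)
  _ _ _ _ _ _ _).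
- by case.
- by case.
- by [].
- by [].
- move=> a e; apply: eq_endo_cell; try exact: eq_functor.
  move=> x; rewrite /cell_cpt /= /horiz_cpt {1}/cell_cpt /=.
  by rewrite cmp1m.
- move=> a e; apply: eq_endo_cell; try exact: eq_functor.
  move=> x; rewrite /cell_cpt /= /horiz_cpt.
  have ei : fmor (cell_src a) (cell_cpt (id_cell (id_functor C)) x)
            = idm C (fob (cell_src a) x).
    by rewrite /cell_cpt /= (fun_idm (functorP (cell_src a))).
  have e1 : tgt C (idm C (fob (cell_src a) x)) = src C (cell_cpt a x).
    by rewrite tgt_idm src_cell_cpt.
  by rewrite (eq_cmp _ e1 (erefl (cell_cpt a x)) ei) cmpm1.
- move=> c b a e1 e2 e3 e4; apply: eq_endo_cell; try exact: eq_functor.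
  move=> x; rewrite /cell_cpt /= /horiz_cpt /=.
  have [Cs Ct _ Cc] := functorP (cell_src c).
  have p : tgt C (fmor (cell_src c) (fmor (cell_src b) (cell_cpt a x)))
      = src C (fmor (cell_src c) (cell_cpt b (fob (cell_tgt a) x))).
    by rewrite Ct Cs horiz_cpt_subproof.
  have q : tgt C (cmp C _ _ p)
      = src C (cell_cpt c (fob (cell_tgt b) (fob (cell_tgt a) x))).
    by rewrite tgt_cmp horiz_cpt_subproof.
  transitivity (cmp C _ _ q).
    by apply: eq_cmp => //; rewrite /cell_cpt /=; apply: Cc.
  by rewrite /cell_cpt /= /horiz_cpt; apply: cmpA.
Defined.

Lemma endo_interchange a b c d
  (ab : cell_tgt a = cell_src b) (cd : cell_tgt c = cell_src d) :
  horiz_cell (vert_cell cd) (vert_cell ab)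
  = vert_cell (b := horiz_cell d b) (a := horiz_cell c a)
      (f_equal2 (@comp_functor C C C) cd ab).
Proof.
apply: eq_endo_cell => //= x.
rewrite /cell_cpt /= /horiz_cpt /= /vert_cpt /= /horiz_cpt.
have [Cs Ct _ Cc] := functorP (cell_src c).
set y := fob (cell_tgt b) x.
pose f := cell_cpt b x.
have fs : src C f = fob (cell_tgt a) x by rewrite src_cell_cpt ab.
have ft : tgt C f = y by rewrite tgt_cell_cpt.
pose Fa := fmor (cell_src c) (cell_cpt a x).
have r1 : tgt C Fa = src C (fmor (cell_src c) f).
  by rewrite Ct Cs tgt_cell_cpt fs.
have r2 : tgt C (fmor (cell_src c) f) = src C (cell_cpt c y).
  by rewrite Ct src_cell_cpt ft.
have r3 : tgt C (cell_cpt c y) = src C (cell_cpt d y).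
  by rewrite tgt_cell_cpt src_cell_cpt cd.
have r4 : tgt C (cell_cpt c (fob (cell_tgt a) x))
          = src C (fmor (cell_src d) f).
  by rewrite -cd tgt_cell_cpt (fun_src (functorP (cell_tgt c))) fs.
have r5 : tgt C Fa = src C (cell_cpt c (fob (cell_tgt a) x)).
  exact: horiz_cpt_subproof.
have r6 : tgt C (fmor (cell_src d) f) = src C (cell_cpt d y).
  exact: horiz_cpt_subproof.
have n : cmp C _ _ r2 = cmp C _ _ r4.
  have n1 : tgt C (fmor (cell_src c) f) = src C (cell_cpt c (tgt C f)).
    by rewrite ft.
  have n2 : tgt C (cell_cpt c (src C f)) = src C (fmor (cell_tgt c) f).
    by rewrite fs r4 cd.
  transitivity (cmp C _ _ n1); first by apply: eq_cmp; rewrite ?ft.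
  by rewrite (cell_naturality n1 n2); apply: eq_cmp; rewrite ?fs ?cd.
have s1 : tgt C (cmp C _ _ r1) = src C (cmp C _ _ r3).
  by rewrite tgt_cmp src_cmp.
transitivity (cmp C _ _ s1).
  apply: eq_cmp; first exact: eq_cmp.
  by rewrite /cell_cpt /= /vert_cpt; apply: Cc.
have s2 : tgt C (cmp C _ _ r1) = src C (cell_cpt c y) by rewrite tgt_cmp.
have s3 : tgt C (cmp C _ _ s2) = src C (cell_cpt d y) by rewrite tgt_cmp.
rewrite -(cmpA s2 r3 s3 s1).
have s4 : tgt C Fa = src C (cmp C _ _ r2) by rewrite src_cmp.
have s5 : tgt C Fa = src C (cmp C _ _ r4) by rewrite src_cmp.
have s6 : tgt C (cmp C _ _ s5) = src C (cell_cpt d y) by rewrite !tgt_cmp.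
have -> : cmp C _ _ s3 = cmp C _ _ s6.
  apply: eq_cmp => //.
  by rewrite (cmpA r1 r2 s2 s4); apply: eq_cmp.
have s7 : tgt C (cmp C _ _ r5) = src C (fmor (cell_src d) f).
  by rewrite tgt_cmp.
have s8 : tgt C (cmp C _ _ s7) = src C (cell_cpt d y) by rewrite tgt_cmp.
have -> : cmp C _ _ s6 = cmp C _ _ s8.
  by apply: eq_cmp => //; rewrite (cmpA r5 r4 s7 s5).
have s9 : tgt C (cmp C _ _ r5) = src C (cmp C _ _ r6).
  by rewrite tgt_cmp src_cmp.
by rewrite (cmpA s7 r6 s8 s9); apply: eq_cmp; apply: eq_cmp.
Qed.

Definition endo_two_category : two_category.
Proof.
refine (@TwoCategory unit (functor C C) endo_cell
  endo_cat1 endo_vert endo_horiz _ _ _ _).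
- by split=> //; case.
- by split=> //; case.
- split=> // G F e e' /=.
  apply: eq_endo_cell => // x.
  rewrite /cell_cpt /= /horiz_cpt.
  have ei : fmor (cell_src (id_cell G)) (cell_cpt (id_cell F) x)
            = idm C (fob G (fob F x)).
    by rewrite /cell_cpt /= (fun_idm (functorP G)).
  have e1 : tgt C (idm C (fob G (fob F x)))
            = src C (cell_cpt (id_cell G) (fob F x)).
    by rewrite tgt_idm src_cell_cpt.
  by rewrite (eq_cmp _ e1 erefl ei) cmpm1.
- move=> a b c d ab cd ac bd e e' /=.
  by rewrite endo_interchange; apply: (@eq_cmp _ _ endo_vert).
Defined.

End EndoTwoCategory.

Record crossed_module (G H : groupType) := CrossedModule {
  bd : UMagmaMorphism.type H G;
  act : G -> H -> H;
  act1 : forall h, act 1 h = h;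
  actM : forall g g' h, act (g * g') h = act g (act g' h);
  act_morph : forall g, {morph act g : h h' / h * h'};
  bd_act : forall g h, bd (act g h) = g * bd h * g^-1;
  peiffer : forall h h', act (bd h) h' = h * h' * h^-1
}.

Section TwoGroup.
Variables (G H : groupType) (X : crossed_module G H).

Lemma act_1 g : act X g 1 = 1.
Proof.
by apply: (mulgI (act X g 1)); rewrite -act_morph !mulg1.
Qed.

Definition tg_cat1 : cat_structure unit G.
Proof.
refine (@CatStructure unit G (fun _ => tt) (fun _ => tt) (fun _ => 1)
  (fun g' g _ => g' * g) _ _ _ _ _ _ _).
- by case.
- by case.
- by [].
- by [].
- by move=> g _; rewrite mul1g.
- by move=> g _; rewrite mulg1.
- by move=> g3 g2 g1 _ _ _ _; rewrite mulgA.
Defined.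

Definition tg_vert : cat_structure G (G * H).
Proof.
refine (@CatStructure G (G * H) (fun a => a.1) (fun a => bd X a.2 * a.1)
  (fun g => (g, 1)) (fun b a _ => (a.1, b.2 * a.2)) _ _ _ _ _ _ _).
- by [].
- by move=> g /=; rewrite gmulf1 mul1g.
- by [].
- by move=> b a e /=; rewrite gmulfM -mulgA e.
- by move=> [g h] e /=; rewrite mul1g.
- by move=> [g h] e /=; rewrite mulg1.
- by move=> c b a *; rewrite /= mulgA.
Defined.

Definition tg_hcomp (b a : G * H) : G * H :=
  (b.1 * a.1, b.2 * act X b.1 a.2).

Lemma tg_hcompA c b a :
  tg_hcomp c (tg_hcomp b a) = tg_hcomp (tg_hcomp c b) a.
Proof. by rewrite /tg_hcomp /= act_morph !mulgA actM. Qed.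

Lemma bd_tg_hcomp b a :
  bd X (tg_hcomp b a).2 * (tg_hcomp b a).1
  = (bd X b.2 * b.1) * (bd X a.2 * a.1).
Proof. by rewrite /= gmulfM bd_act !mulgA mulgVK. Qed.

Definition tg_horiz : cat_structure unit (G * H).
Proof.
refine (@CatStructure unit (G * H) (fun _ => tt) (fun _ => tt)
  (fun _ => (1, 1)) (fun b a _ => tg_hcomp b a) _ _ _ _ _ _ _).
- by case.
- by case.
- by [].
- by [].
- by move=> [g h] _; rewrite /tg_hcomp /= act1 !mul1g.
- by move=> [g h] _; rewrite /tg_hcomp /= act_1 !mulg1.
- by move=> c b a _ _ _ _; apply: tg_hcompA.
Defined.

Lemma tg_interchange (g1 g2 : G) (h1 h1' h2 h2' : H) :
  (h2' * h2) * act X g2 (h1' * h1)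
  = (h2' * act X (bd X h2 * g2) h1') * (h2 * act X g2 h1).
Proof.
by rewrite act_morph actM peiffer !mulgA mulgVK.
Qed.

Definition two_group : two_category.
Proof.
refine (@TwoCategory unit G (G * H) tg_cat1 tg_vert tg_horiz _ _ _ _).
- by split=> //; case.
- split=> [f|f|x|b a e e'] //=; first by rewrite gmulf1 mul1g.
  exact: bd_tg_hcomp.
- split=> // b a e e' /=.
  by rewrite /tg_hcomp /= act_1 mul1g.
- move=> [ga ha] [gb hb] [gc hc] [gd hd] /= ab cd _ _ _ e'.
  by rewrite /tg_hcomp /= tg_interchange // -cd.
Defined.

End TwoGroup.

(* A strict action on C is a strict 2-functor from the 2-group to Cat sending
   its unique object to C. *)
Definition strict_action (G H : groupType) (X : crossed_module G H)
    (C : category) :=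
  two_functor (two_group X) (endo_two_category C).

Record set_action (G : groupType) (T : Type) := SetAction {
  set_act : G -> T -> T;
  set_act1 : forall x, set_act 1 x = x;
  set_actM : forall g g' x, set_act (g * g') x = set_act g (set_act g' x)
}.

Section TransformationGroupoid.
Variables (G : groupType) (T : Type) (A : set_action G T).

Definition transf_structure : cat_structure T (G * T).
Proof.
refine (@CatStructure T (G * T) (fun p => p.2) (fun p => set_act A p.1 p.2)
  (fun x => (1, x)) (fun q p _ => (q.1 * p.1, p.2)) _ _ _ _ _ _ _).
- by [].
- by move=> x; apply: set_act1.
- by [].
- by move=> q p e /=; rewrite set_actM e.
- by move=> [g x] e /=; rewrite mul1g.
- by move=> [g x] e /=; rewrite mulg1.
- by move=> r q p *; rewrite /= mulgA.
Defined.

Definition transformation_groupoid : groupoid.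
Proof.
refine (@Groupoid (Category transf_structure)
  (fun p => (p.1^-1, set_act A p.1 p.2)) _ _ _ _).
- by [].
- by move=> [g x] /=; rewrite -set_actM mulVg set_act1.
- by move=> [g x] e /=; rewrite mulVg.
- by move=> [g x] e /=; rewrite mulgV.
Defined.

End TransformationGroupoid.

Section Action.
Variables (G H : groupType) (X : crossed_module G H) (C : category).
Variable Phi : strict_action X C.

(* [Phi1 g], [act_ob g x], [Phi2_at (g, h) x] and [act_mor (g, h) f] are
   Phi_g, g |> x, Phi_(g,h)(x) and (g, h) |> f. *)
Definition Phi1 (g : G) : functor C C := map1 Phi g.

Definition Phi2 (a : G * H) : endo_cell C := map2 Phi a.

Definition act_ob (g : G) (x : ob C) : ob C := fob (Phi1 g) x.

Lemma src_Phi2 a : cell_src (Phi2 a) = Phi1 a.1.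
Proof. exact: (fun_src (map_vert Phi)). Qed.

Lemma tgt_Phi2 a : cell_tgt (Phi2 a) = Phi1 (bd X a.2 * a.1).
Proof. exact: (fun_tgt (map_vert Phi)). Qed.

Lemma Phi1_1 : Phi1 1 = id_functor C.
Proof. exact: (fun_idm (map_cat1 Phi) tt). Qed.

Lemma Phi1_M g g' : Phi1 (g * g') = comp_functor (Phi1 g) (Phi1 g').
Proof. exact: (fun_cmp (map_cat1 Phi) (g := g) (f := g') erefl erefl). Qed.

Lemma act_ob1 x : act_ob 1 x = x.
Proof. by rewrite /act_ob Phi1_1. Qed.

Lemma act_obM g g' x : act_ob (g * g') x = act_ob g (act_ob g' x).
Proof. by rewrite /act_ob Phi1_M. Qed.

Definition object_action : set_action G (ob C) := SetAction act_ob1 act_obM.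

Definition Phi2_at (a : G * H) (x : ob C) : mor C := cell_cpt (Phi2 a) x.

Lemma src_Phi2_at a x : src C (Phi2_at a x) = act_ob a.1 x.
Proof. by rewrite /Phi2_at src_cell_cpt src_Phi2. Qed.

Lemma tgt_Phi2_at a x : tgt C (Phi2_at a x) = act_ob (bd X a.2 * a.1) x.
Proof. by rewrite /Phi2_at tgt_cell_cpt tgt_Phi2. Qed.

Lemma act_mor_subproof a f :
  tgt C (fmor (Phi1 a.1) f) = src C (Phi2_at a (tgt C f)).
Proof. by rewrite (fun_tgt (functorP _)) src_Phi2_at. Qed.

Definition act_mor (a : G * H) (f : mor C) : mor C :=
  cmp C (Phi2_at a (tgt C f)) (fmor (Phi1 a.1) f) (act_mor_subproof a f).

Lemma src_act_mor a f : src C (act_mor a f) = act_ob a.1 (src C f).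
Proof. by rewrite src_cmp (fun_src (functorP _)). Qed.

Lemma tgt_act_mor a f :
  tgt C (act_mor a f) = act_ob (bd X a.2 * a.1) (tgt C f).
Proof. by rewrite tgt_cmp tgt_Phi2_at. Qed.

Lemma Phi2_naturality a f e :
  act_mor a f
  = cmp C (fmor (Phi1 (bd X a.2 * a.1)) f) (Phi2_at a (src C f)) e.
Proof.
have e1 : tgt C (fmor (cell_src (Phi2 a)) f) = src C (Phi2_at a (tgt C f)).
  by rewrite src_Phi2 act_mor_subproof.
have e2 : tgt C (Phi2_at a (src C f)) = src C (fmor (cell_tgt (Phi2 a)) f).
  by rewrite tgt_Phi2 e.
transitivity (cmp C _ _ e1); first by apply: eq_cmp; rewrite ?src_Phi2.
rewrite [LHS](cell_naturality e1 e2).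
by apply: eq_cmp; rewrite ?tgt_Phi2.
Qed.

Lemma Phi2_at_vert g h h' x e :
  Phi2_at (g, h' * h) x
  = cmp C (Phi2_at (bd X h * g, h') x) (Phi2_at (g, h) x) e.
Proof.
have e1 : cell_tgt (Phi2 (g, h)) = cell_src (Phi2 (bd X h * g, h')).
  by rewrite src_Phi2 tgt_Phi2.
have /= E := fun_cmp (map_vert Phi) (g := (bd X h * g, h')) (f := (g, h))
  erefl e1.
rewrite /Phi2_at /Phi2 E {1}/cell_cpt /= /vert_cpt.
exact: eq_cmp.
Qed.

Lemma Phi2_at_idm g x : Phi2_at (g, 1) x = idm C (act_ob g x).
Proof.
have /= E := fun_idm (map_vert Phi) g.
by rewrite /Phi2_at /Phi2 E.
Qed.

Lemma Phi2_at_horiz b a x e :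
  Phi2_at (tg_hcomp X b a) x
  = cmp C (Phi2_at b (act_ob (bd X a.2 * a.1) x))
      (fmor (Phi1 b.1) (Phi2_at a x)) e.
Proof.
have /= E := fun_cmp (map_horiz Phi) (g := b) (f := a) erefl erefl.
rewrite /Phi2_at /Phi2 E {1}/cell_cpt /= /horiz_cpt.
have Et := tgt_Phi2 a; have Es := src_Phi2 b; rewrite /Phi2 in Et Es.
by apply: eq_cmp; rewrite ?Et ?Es.
Qed.

Lemma act_mor_idm a x : act_mor a (idm C x) = Phi2_at a x.
Proof.
have e1 : tgt C (idm C (act_ob a.1 x)) = src C (Phi2_at a x).
  by rewrite tgt_idm src_Phi2_at.
transitivity (cmp C _ _ e1); last exact: cmpm1.
by apply: eq_cmp; rewrite ?tgt_idm // (fun_idm (functorP _)).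
Qed.

Lemma act_mor_id1 f : act_mor (1, 1) f = f.
Proof.
have e1 : tgt C f = src C (idm C (tgt C f)) by rewrite src_idm.
transitivity (cmp C _ _ e1); last exact: cmp1m.
by apply: eq_cmp; rewrite ?Phi1_1 // Phi2_at_idm act_ob1.
Qed.

Lemma act_mor_cmp (a b : G * H) f g (ab : bd X a.2 * a.1 = b.1)
    (fg : tgt C f = src C g) e :
  act_mor (a.1, b.2 * a.2) (cmp C g f fg)
  = cmp C (act_mor b g) (act_mor a f) e.
Proof.
case: a b ab e => [ga ha] [_ hb] /= <- e.
set b := (bd X ha * ga, hb); set a := (ga, ha).
have ea : tgt C (Phi2_at a (src C g)) = src C (fmor (Phi1 (bd X ha * ga)) g).
  by rewrite tgt_Phi2_at (fun_src (functorP _)).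
have eb := act_mor_subproof b g; rewrite /= in eb.
have ef : tgt C (fmor (Phi1 ga) f) = src C (fmor (Phi1 ga) g).
  by rewrite (fun_tgt (functorP _)) (fun_src (functorP _)) fg.
have eg := act_mor_subproof a g; rewrite /= in eg.
have eba : tgt C (Phi2_at a (tgt C g)) = src C (Phi2_at b (tgt C g)).
  by rewrite tgt_Phi2_at src_Phi2_at.
have p1 : tgt C (cmp C _ _ ef) = src C (cmp C _ _ eba).
  by rewrite tgt_cmp src_cmp eg.
transitivity (cmp C _ _ p1).
  apply: eq_cmp.
    by rewrite tgt_cmp; apply: Phi2_at_vert.
  exact: (fun_cmp (functorP _)).
have p2 : tgt C (cmp C _ _ ef) = src C (Phi2_at a (tgt C g)).
  by rewrite tgt_cmp eg.
have p3 : tgt C (cmp C _ _ p2) = src C (Phi2_at b (tgt C g)).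
  by rewrite tgt_cmp.
rewrite -(cmpA p2 eba p3 p1).
have q1 : tgt C (fmor (Phi1 ga) f) = src C (Phi2_at a (src C g)).
  by rewrite (fun_tgt (functorP _)) src_Phi2_at fg.
have q2 : tgt C (fmor (Phi1 ga) f) = src C (cmp C _ _ eg).
  by rewrite ef src_cmp.
have q3 : tgt C (fmor (Phi1 ga) f) = src C (cmp C _ _ ea).
  by rewrite src_cmp.
have q4 : tgt C (act_mor a f) = src C (fmor (Phi1 (bd X ha * ga)) g).
  by rewrite tgt_act_mor fg (fun_src (functorP _)).
have q5 : tgt C (cmp C _ _ q1) = src C (fmor (Phi1 (bd X ha * ga)) g).
  by rewrite tgt_cmp.
have q6 : tgt C (cmp C _ _ q4) = src C (Phi2_at b (tgt C g)).
  by rewrite tgt_cmp.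
transitivity (cmp C _ _ q6); last first.
  have q7 : tgt C (act_mor a f) = src C (cmp C _ _ eb) by rewrite src_cmp.
  by rewrite (cmpA q4 eb q6 q7); apply: eq_cmp => //; apply: eq_cmp.
apply: eq_cmp => //.
rewrite (cmpA ef eg p2 q2).
transitivity (cmp C _ _ q3).
  apply: eq_cmp => //.
  by rewrite -(Phi2_naturality (a := a) ea); apply: eq_cmp.
rewrite -(cmpA q1 ea q5 q3).
by apply: eq_cmp => //; apply: eq_cmp; rewrite ?fg.
Qed.

Lemma act_mor_hcomp b a f :
  act_mor (tg_hcomp X b a) f = act_mor b (act_mor a f).
Proof.
have [Bs Bt _ Bc] := functorP (Phi1 b.1).
have p1 : tgt C (fmor (Phi1 b.1) (fmor (Phi1 a.1) f))
          = src C (fmor (Phi1 b.1) (Phi2_at a (tgt C f))).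
  by rewrite Bt Bs act_mor_subproof.
have p2 : tgt C (fmor (Phi1 b.1) (Phi2_at a (tgt C f)))
          = src C (Phi2_at b (act_ob (bd X a.2 * a.1) (tgt C f))).
  by rewrite Bt tgt_Phi2_at src_Phi2_at.
have p3 : tgt C (cmp C _ _ p1)
          = src C (Phi2_at b (act_ob (bd X a.2 * a.1) (tgt C f))).
  by rewrite tgt_cmp.
have p4 : tgt C (fmor (Phi1 b.1) (fmor (Phi1 a.1) f)) = src C (cmp C _ _ p2).
  by rewrite src_cmp.
transitivity (cmp C _ _ p4).
  by apply: eq_cmp; [exact: Phi2_at_horiz | rewrite /= Phi1_M].
rewrite -(cmpA p1 p2 p3 p4).
apply: eq_cmp; first by rewrite tgt_act_mor.
by rewrite -(Bc _ _ (act_mor_subproof a f)).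
Qed.

(* The pair ((g, h), f) is the square with top edge f and bottom edge
   (g, h) |> f, where |> is [act_mor]. *)
Definition sq_left (s : (G * H) * mor C) : G * ob C := (s.1.1, src C s.2).

Definition sq_right (s : (G * H) * mor C) : G * ob C :=
  (bd X s.1.2 * s.1.1, tgt C s.2).

Lemma hsq_subproof s2 s1 : sq_right s1 = sq_left s2 ->
  tgt C s1.2 = src C s2.2.
Proof. by case. Qed.

Definition hsq s2 s1 (e : sq_right s1 = sq_left s2) : (G * H) * mor C :=
  ((s1.1.1, s2.1.2 * s1.1.2), cmp C s2.2 s1.2 (hsq_subproof e)).

Definition transf_sqh : cat_structure (G * ob C) ((G * H) * mor C).
Proof.
refine (@CatStructure (G * ob C) ((G * H) * mor C) sq_left sq_right
  (fun p => ((p.1, 1), idm C p.2)) hsq _ _ _ _ _ _ _);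
  rewrite /sq_left /sq_right /hsq.
- by move=> [g x] /=; rewrite src_idm.
- by move=> [g x] /=; rewrite tgt_idm gmulf1 mul1g.
- by move=> s2 s1 e /=; rewrite src_cmp.
- move=> [[g2 h2] f2] [[g1 h1] f1] e /=.
  by rewrite tgt_cmp gmulfM; case: e => <- _; rewrite mulgA.
- by move=> [[g h] f] e /=; rewrite mul1g cmp1m.
- by move=> [[g h] f] e /=; rewrite mulg1 cmpm1.
- move=> s3 s2 s1 e1 e2 e3 e4 /=.
  congr (_, _); first by rewrite mulgA.
  exact: cmpA.
Defined.

Definition transf_sqv : cat_structure (mor C) ((G * H) * mor C).
Proof.
refine (@CatStructure (mor C) ((G * H) * mor C)
  (fun s => s.2) (fun s => act_mor s.1 s.2) (fun f => ((1, 1), f))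
  (fun s2 s1 _ => (tg_hcomp X s2.1 s1.1, s1.2)) _ _ _ _ _ _ _).
- by [].
- exact: act_mor_id1.
- by [].
- by move=> s2 s1 e; rewrite /= act_mor_hcomp e.
- by move=> [[g h] f] e; rewrite /tg_hcomp /= act1 !mul1g.
- by move=> [[g h] f] e; rewrite /tg_hcomp /= act_1 !mulg1.
- by move=> s3 s2 s1 *; rewrite /= tg_hcompA.
Defined.

Definition transformation_double_category : double_category.
Proof.
refine (@DoubleCategory (ob C) (mor C) (G * ob C) ((G * H) * mor C)
  C (transformation_groupoid object_action) transf_sqh transf_sqv
  _ _ _ _ _ _ _).
- split=> [s|s|[g x]|t s e e'] //=; exact: eq_cmp.
- split=> [s|s|[g x]|s2 s1 e e'] /=.
  + exact: src_act_mor.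
  + exact: tgt_act_mor.
  + by rewrite act_mor_idm Phi2_at_idm.
  + by apply: act_mor_cmp; case: e.
- by split=> // s; rewrite /= src_act_mor.
- split=> [s|s|f|s2 s1 e e'] //=.
  + by rewrite tgt_act_mor.
  + by rewrite /sq_right /= gmulf1 mulg1.
  + by rewrite /sq_right /= gmulfM bd_act !mulgA mulgVK.
- split=> [f|f|x|g f e e'] //=.
  + by rewrite /sq_right /= gmulf1 mulg1.
  + by congr (_, _); [rewrite mulg1 | apply: eq_cmp].
- split=> [[g x]|[g x]|x|q p e e'] //=.
  + by rewrite act_mor_idm Phi2_at_idm.
  + by rewrite /tg_hcomp /= act_1 mulg1.
- move=> [[ga ha] fa] [[gb hb] fb] [[gc hc] fc] [[gd hd] fd] ab cd ac bd e e'.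
  congr (_, _); last exact: eq_cmp.
  rewrite /tg_hcomp /=; congr (_, _).
  by have [/= <- _] := cd; apply: tg_interchange.
Defined.

End Action.

Section VerticalTwoCategory.
Variable D : double_category.

(* Squares of D whose top and bottom edges are identities; as 2-morphisms they
   go from their left edge to their right edge, so that [v_vert] is the
   horizontal composition of squares and [v_horiz] the vertical one. *)
Definition vcell_pred (s : sq D) : Prop :=
  is_idm (hcat D) (src (sqv D) s) /\ is_idm (hcat D) (tgt (sqv D) s).

Definition vcell := {s : sq D | vcell_pred s}.

Lemma eq_vcell (a b : vcell) : sval a = sval b -> a = b.
Proof. by case: a b => [s p] [t q] /= e; apply: eq_exist. Qed.

Lemma src_idm_sq s : vcell_pred s ->
  src (sqv D) s = idm (hcat D) (src (vcat D) (src (sqh D) s)).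
Proof.
move=> [[x ex] _]; have es := fun_src (top_functor D) s.
by rewrite -es ex src_idm.
Qed.

Lemma tgt_idm_sq s : vcell_pred s ->
  tgt (sqv D) s = idm (hcat D) (tgt (vcat D) (src (sqh D) s)).
Proof.
move=> [_ [x ex]]; have es := fun_src (bottom_functor D) s.
by rewrite -es ex src_idm.
Qed.

Lemma vcell_src_right s : vcell_pred s ->
  src (vcat D) (tgt (sqh D) s) = src (vcat D) (src (sqh D) s).
Proof.
move=> [[x ex] _]; rewrite -(fun_src (top_functor D)).
by rewrite -(fun_tgt (top_functor D)) ex src_idm tgt_idm.
Qed.

Lemma vcell_tgt_right s : vcell_pred s ->
  tgt (vcat D) (tgt (sqh D) s) = tgt (vcat D) (src (sqh D) s).
Proof.
move=> [_ [x ex]]; rewrite -(fun_src (bottom_functor D)).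
by rewrite -(fun_tgt (bottom_functor D)) ex src_idm tgt_idm.
Qed.

Lemma idh_vcell u : vcell_pred (idm (sqh D) u).
Proof.
split; [exists (src (vcat D) u) | exists (tgt (vcat D) u)].
  exact: (fun_idm (top_functor D)).
exact: (fun_idm (bottom_functor D)).
Qed.

Lemma hcomp_vcell t s e : vcell_pred t -> vcell_pred s ->
  vcell_pred (cmp (sqh D) t s e).
Proof.
move=> [[x ex] [y ey]] [[x' ex'] [y' ey']].
split; [exists x' | exists y'].
  have e1 : tgt (hcat D) (src (sqv D) s) = src (hcat D) (src (sqv D) t).
    by rewrite (fun_src (top_functor D)) (fun_tgt (top_functor D)) e.
  rewrite (fun_cmp (top_functor D) e e1) -ex'.
  have e2 := e1; rewrite ex in e2.
  by rewrite (eq_cmp e1 e2 ex erefl) cmp1m.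
have e1 : tgt (hcat D) (tgt (sqv D) s) = src (hcat D) (tgt (sqv D) t).
  by rewrite (fun_src (bottom_functor D)) (fun_tgt (bottom_functor D)) e.
rewrite (fun_cmp (bottom_functor D) e e1) -ey'.
have e2 := e1; rewrite ey in e2.
by rewrite (eq_cmp e1 e2 ey erefl) cmp1m.
Qed.

Lemma vcomp_vcell t s e : vcell_pred t -> vcell_pred s ->
  vcell_pred (cmp (sqv D) t s e).
Proof. by move=> [_ tb] [st _]; rewrite /vcell_pred src_cmp tgt_cmp. Qed.

Definition v_vert : cat_structure (vmor D) vcell.
Proof.
refine (@CatStructure (vmor D) vcell
  (fun a => src (sqh D) (sval a)) (fun a => tgt (sqh D) (sval a))
  (fun u => exist _ (idm (sqh D) u) (idh_vcell u))
  (fun b a e => exist _ (cmp (sqh D) (sval b) (sval a) e)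
                  (hcomp_vcell e (svalP b) (svalP a)))
  _ _ _ _ _ _ _).
- by move=> u; apply: src_idm.
- by move=> u; apply: tgt_idm.
- by move=> b a e; apply: src_cmp.
- by move=> b a e; apply: tgt_cmp.
- by move=> a e; apply: eq_vcell; apply: cmp1m.
- by move=> a e; apply: eq_vcell; apply: cmpm1.
- by move=> c b a e1 e2 e3 e4; apply: eq_vcell; apply: cmpA.
Defined.

Definition vcell_src (a : vcell) : dob D :=
  src (vcat D) (src (sqh D) (sval a)).

Definition vcell_tgt (a : vcell) : dob D :=
  tgt (vcat D) (src (sqh D) (sval a)).

Lemma v_horiz_subproof (b a : vcell) : vcell_tgt a = vcell_src b ->
  tgt (sqv D) (sval a) = src (sqv D) (sval b).
Proof.
move=> e; rewrite (src_idm_sq (svalP b)) (tgt_idm_sq (svalP a)).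
by congr (idm _ _).
Qed.

Definition v_horiz : cat_structure (dob D) vcell.
Proof.
refine (@CatStructure (dob D) vcell vcell_src vcell_tgt
  (fun x => exist _ (idm (sqh D) (idm (vcat D) x)) (idh_vcell _))
  (fun b a e => exist _ (cmp (sqv D) (sval b) (sval a) (v_horiz_subproof e))
     (vcomp_vcell (v_horiz_subproof e) (svalP b) (svalP a)))
  _ _ _ _ _ _ _); rewrite /vcell_src /vcell_tgt /=.
- by move=> x; rewrite !src_idm.
- by move=> x; rewrite src_idm tgt_idm.
- move=> b a e; rewrite -!(fun_src (top_functor D)).
  by rewrite src_cmp.
- move=> b a e; rewrite -!(fun_src (bottom_functor D)).
  by rewrite tgt_cmp.
- move=> a e; apply: eq_vcell.
  exact: (is_idm_cmp1m _ (fun_idm (idh_functor D) _)).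
- move=> a e; apply: eq_vcell.
  exact: (is_idm_cmpm1 _ (fun_idm (idh_functor D) _)).
- by move=> c b a e1 e2 e3 e4; apply: eq_vcell; apply: cmpA.
Defined.

Definition vertical_two_category : two_category.
Proof.
refine (@TwoCategory (dob D) (vmor D) vcell (vcat D) v_vert v_horiz _ _ _ _).
- split=> // [x|b a e e'] /=; first exact: src_idm.
  exact: (fun_cmp (left_functor D)).
- split=> [a|a|x|b a e e'] /=.
  + exact: vcell_src_right (svalP a).
  + exact: vcell_tgt_right (svalP a).
  + exact: tgt_idm.
  + exact: (fun_cmp (right_functor D)).
- split=> [u|u|x|v u e e'] /=;
    rewrite /vcell_src /vcell_tgt /= ?src_idm //.
  by apply: eq_vcell; apply: (fun_cmp (idh_functor D)).
- move=> a b c d ab cd ac bd e e'; apply: eq_vcell => /=.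
  exact: interchange.
Defined.

End VerticalTwoCategory.

Definition one_category (B : two_category) : category := Category (cat1 B).

Definition two_hom (B : two_category) (u v : mor1 B) :=
  {a : cell B | src (vert B) a = u /\ tgt (vert B) a = v}.

Arguments two_hom : clear implicits.

(* Main.v *)
(* A square ((g, h), f) has identity top edge iff f = idm x; its bottom edge
   (g, h) |> idm x is then Phi_(g,h)(x), so a 2-morphism of the vertical
   2-category is exactly a triple (g, h, x) with Phi_(g,h)(x) an identity. *)

Require Import Defs.
From mathcomp Require Import all_boot.
From mathcomp Require Import boolp.

Set Implicit Arguments.
Unset Strict Implicit.
Unset Printing Implicit Defensive.

(** Since [src_idm] recovers the object from its identity, the witness hidden in [is_idm] can only
    be the source. *)
Lemma is_idmE O M (S : cat_structure O M) (f : M) :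
  is_idm S f <-> f = idm S (src S f).
Proof.
by split=> [[x ->] | e]; [rewrite src_idm | exists (src S f)].
Qed.

Section TransformationVerticalCells.
Variables (G H : groupType) (X : crossed_module G H) (C : category).
Variable Phi : strict_action X C.

Let D := transformation_double_category Phi.

Lemma transf_vcellP (g : G) (h : H) (f : mor C) :
  vcell_pred (D := D) ((g, h), f)
  <-> f = idm C (src C f)
      /\ Phi2_at Phi (g, h) (src C f) = idm C (act_ob Phi g (src C f)).
Proof.
rewrite /vcell_pred; split=> -[].
  (* The bottom edge is the identity at its own source, which [src_act_mor] computes. *)
  move=> /is_idmE /= ef /is_idmE /=; rewrite {1 3}ef src_act_mor /=.
  by rewrite !act_mor_idm => ->.
move=> /= ef ePhi; split; first exact/is_idmE.
by exists (act_ob Phi g (src C f)); rewrite /= {1}ef act_mor_idm.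
Qed.

(** The left edge fixes [k] and the source of [f], so only [h] remains free; the right edge then
    forces [g']. *)
Lemma transf_two_homP (x : ob C) (g g' k : G) (h : H) (f : mor C)
    (p : vcell_pred (D := D) ((k, h), f)) :
  let V := vertical_two_category D in
  let a : cell V := exist _ ((k, h), f) p in
  src (vert V) a = (g, x) -> tgt (vert V) a = (g', x) ->
  [/\ k = g, f = idm C x,
      Phi2_at Phi (g, h) x = idm C (act_ob Phi g x)
    & g' = (bd X h * g)%g].
Proof.
move=> V a [/= <- es] [/= <- _].
by have [ef ePhi] := (transf_vcellP k h f).1 p; rewrite -es.
Qed.

End TransformationVerticalCells.

Theorem theorem4p17 (G H : groupType) (X : crossed_module G H) (C : category)
    (Phi : strict_action X C) :
  let D := transformation_double_category Phi in
  let V := vertical_two_category D in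
  one_category V = transformation_groupoid (object_action Phi) :> category
  /\ forall (x : ob C) (gamma gamma' : G),
       act_ob Phi gamma x = act_ob Phi gamma' x ->
       exists F : {chi : H |
                    Phi2_at Phi (gamma, chi) x = idm C (act_ob Phi gamma x)
                    /\ gamma' = (bd X chi * gamma)%g} ->
                  two_hom V (gamma, x) (gamma', x),
         bijective F
         /\ forall c, sval (sval (F c)) = ((gamma, sval c), idm C x).
Proof.
(* The equality of categories holds by computation, the vertical category of [D] being the groupoid
   by construction. *)
move=> D V; split=> // x g g' _.
pose P h := Phi2_at Phi (g, h) x = idm C (act_ob Phi g x)
            /\ g' = (bd X h * g)%g.
have cellP h : Phi2_at Phi (g, h) x = idm C (act_ob Phi g x) ->
    vcell_pred (D := D) ((g, h), idm C x).
  by move=> ePhi; apply/transf_vcellP; rewrite src_idm.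
have homP h (c : P h) :
    let a : cell V := exist _ ((g, h), idm C x) (cellP h (proj1 c)) in
    src (vert V) a = (g, x) /\ tgt (vert V) a = (g', x).
  by rewrite /= /sq_left /sq_right /= src_idm tgt_idm -(proj2 c).
exists (fun c => exist _ (exist _ _ (cellP _ (proj1 (svalP c))))
                    (homP _ (svalP c))).
split=> //.
(* The inverse of [F] reads [chi] off the square. *)
have invP (a : two_hom V (g, x) (g', x)) : P (sval (sval a)).1.2.
  case: a => [[[[k h] f] p] [es et]] /=.
  by have [_ _ ePhi eg] := transf_two_homP es et.
exists (fun a => exist P _ (invP a)) => [[h c] | [[[[k h] f] p] [es et]]].
  exact: eq_exist.
(* By proof irrelevance at both subset layers, it suffices to compare the underlying squares. *)
apply: eq_exist; apply: eq_vcell => /=.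
by have [-> -> _ _] := transf_two_homP es et.
Qed.
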